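(* Every incoherent operation (IO) acting on a single qutrit $\mathcal{H}_3$ admits a Kraus decomposition $\Phi(\rho)=\sum_{n=1}^N K_n\rho K_n^\dagger$ with at most $N=32$ incoherent Kraus operators.
   Context: Fix an orthonormal basis $\{|i\rangle\}_{i=1}^d$ of $\mathcal{H}_d$. A state is incoherent if it is diagonal in this basis, i.e. of the form $\delta=\sum_{i=1}^d\delta_i|i\rangle\langle i|$ with $\delta_i\ge 0$, $\sum_i\delta_i=1$; let $\mathcal{I}$ denote the set of incoherent states. A completely positive trace-preserving map $\Phi$ is an incoherent operation (IO) if it has a Kraus representation $\Phi(\rho)=\sum_n K_n\rho K_n^\dagger$, $\sum_n K_n^\dagger K_n=I$, such that $K_n\rho K_n^\dagger/\mathrm{Tr}[K_n\rho K_n^\dagger]\in\mathcal{I}$ for all $n$ and all $\rho\in\mathcal{I}$ (whenever the trace is nonzero); such Kraus operators are called incoherent Kraus operators (equivalently, each column of each $K_n$ has at most one nonzero entry). *)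

(* Defs.v *)
From HB Require Import structures.
From mathcomp Require Import all_boot all_order all_algebra.
From mathcomp Require Import complex.
From mathcomp Require Import Rstruct.
Set Implicit Arguments. Unset Strict Implicit. Unset Printing Implicit Defensive.
Import Order.TTheory GRing.Theory Num.Theory.
Local Open Scope ring_scope.

(* The complex numbers: R[i] over the (Stdlib) real numbers R. *)
Definition C : Type := complex Rdefinitions.R.

(* Conjugate transpose of a square matrix. *)
Definition adjoint (d : nat) (A : 'M[C]_d) : 'M[C]_d :=
  (map_mx (fun z : C => z^*) A)^T.

(* Incoherent states: diagonal in the fixed (standard) basis, with
   nonnegative diagonal entries summing to 1. *)
Definition incoherent_state (d : nat) (delta : 'M[C]_d) : Prop :=
  (forall i j : 'I_d, i != j -> delta i j = 0) /\
  (forall i : 'I_d, 0 <= delta i i) /\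
  \tr delta = 1.

(* Incoherent Kraus operator: maps every incoherent state (after
   normalization, when the trace is nonzero) to an incoherent state. *)
Definition incoherent_kraus (d : nat) (K : 'M[C]_d) : Prop :=
  forall delta : 'M[C]_d, incoherent_state delta ->
    \tr (K *m delta *m adjoint K) != 0 ->
    incoherent_state ((\tr (K *m delta *m adjoint K))^-1 *: (K *m delta *m adjoint K)).

(* Phi has an incoherent Kraus representation with N operators Ks. *)
Definition incoherent_kraus_rep (d N : nat) (Phi : 'M[C]_d -> 'M[C]_d)
    (Ks : 'I_N -> 'M[C]_d) : Prop :=
  (\sum_(n < N) adjoint (Ks n) *m Ks n = 1%:M) /\
  (forall n, incoherent_kraus (Ks n)) /\
  (forall rho : 'M[C]_d, Phi rho = \sum_(n < N) Ks n *m rho *m adjoint (Ks n)).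

(* Incoherent operation (IO): a CPTP map admitting some (finite) Kraus
   representation by incoherent Kraus operators. *)
Definition incoherent_operation (d : nat) (Phi : 'M[C]_d -> 'M[C]_d) : Prop :=
  exists N (Ks : 'I_N -> 'M[C]_d), incoherent_kraus_rep Phi Ks.

(* Main.v *)
Require Import Defs.
From mathcomp Require Import all_boot all_order all_algebra.
From mathcomp Require Import complex Rstruct.
From mathcomp Require Import ring zify.
Set Implicit Arguments. Unset Strict Implicit. Unset Printing Implicit Defensive.
Import Order.TTheory GRing.Theory Num.Theory.
Local Open Scope ring_scope.
Local Open Scope sesquilinear_scope.

(** An incoherent Kraus operator has at most one nonzero entry per column, in
    row [f j] of column [j]. A Cholesky factorisation of the Gram matrix of the
    operators with a given [f] leaves one operator with nonzero first column
    for each of the 27 functions [f], the others having zero first column.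
    Operators sharing the line [(f 1, f 2)] may be mixed, unless both have a
    nonzero first column. If a line carries [k <= 3] operators with and [r]
    without first column, the Hermitian mixing matrices form a space of
    dimension [k + 2kr + r^2 >= 7(k + r) - 18]; over the 9 lines this is at
    least [7N - 162], while the Choi matrices of incoherent operations span a
    space of dimension 63. Hence for [N >= 33] some Hermitian [H <> 0] can be
    added to the identity mixing without changing the map, and a multiple of
    it makes [1 + t H] positive semidefinite and singular. The mixing pattern
    is chordal, so the Cholesky factor of [1 + t H] stays inside it, and its
    zero column removes one Kraus operator. *)

(** * Gram matrices, Cholesky factors and Hermitian perturbations of the identity *)

Section LinearAlgebra.
Variable F : numClosedFieldType.

Lemma trmxCE m n (A : 'M[F]_(m, n)) i j : (A ^t*) i j = (A j i)^*.
Proof. by rewrite !mxE. Qed.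

Lemma trmxC_mul m n p (A : 'M[F]_(m, n)) (B : 'M[F]_(n, p)) :
  (A *m B) ^t* = B ^t* *m A ^t*.
Proof. by rewrite trmx_mul map_mxM. Qed.

Lemma row_dnorm_ge0 n (a : 'rV[F]_n) : 0 <= (a *m a ^t*) 0 0.
Proof. by rewrite mxE sumr_ge0 // => i _; rewrite trmxCE mul_conjC_ge0. Qed.

Lemma row_dnorm_eq0 n (a : 'rV[F]_n) : (a *m a ^t*) 0 0 = 0 -> a = 0.
Proof.
rewrite mxE => /eqP; rewrite psumr_eq0; last first.
  by move=> i _; rewrite trmxCE mul_conjC_ge0.
move=> /allP a0; apply/rowP => i; rewrite mxE.
by have := a0 i (mem_index_enum _); rewrite trmxCE mul_conjC_eq0 => /eqP.
Qed.

(* Cholesky factorisation of a Gram matrix: elimination of the first row keeps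
   the matrix a Gram matrix and, [E] being a perfect elimination pattern,
   creates no entry outside [E]. *)
Lemma chordal_cholesky N k (A : 'M[F]_(N, k)) (E : rel 'I_N) :
    (forall n, E n n) ->
    (forall m n p : 'I_N, (m < n)%N -> (m < p)%N -> E n m -> E p m -> E n p) ->
    (forall n m, (A *m A ^t*) n m != 0 -> E n m) ->
  exists L : 'M[F]_N,
    [/\ A *m A ^t* = L *m L ^t*,
        forall n m : 'I_N, (n < m)%N -> L n m = 0,
        forall n m, L n m != 0 -> E n m &
        forall m, L m m = 0 -> forall n, L n m = 0].
Proof.
elim: N A E => [|N IH] A E Erefl Echord EA.
  exists 0; split; try by case.
  by apply/matrixP; case.
move: A E Erefl Echord EA; change N.+1 with (1 + N)%N => A E Erefl Echord EA.
pose a := usubmx A; pose A' := dsubmx A.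
have [b [b_ge0 aaE b_eq0]] : exists b : F, [/\ 0 <= b, a *m a ^t* = b%:M & b = 0 -> a = 0].
  exists ((a *m a ^t*) 0 0); split; [exact: row_dnorm_ge0| |exact: row_dnorm_eq0].
  by apply/matrixP => i j; rewrite !ord1 [RHS]mxE.
have defA : A = col_mx a A' by rewrite vsubmxK.
pose s := sqrtC b; pose v : 'cV[F]_N := s^-1 *: (A' *m a ^t*).
have ss : s * s = b by rewrite -expr2 sqrtCK.
have sC : s^* = s by apply/CrealP/ger0_real; rewrite sqrtC_ge0.
have sVC : s^-1^* = s^-1 by rewrite fmorphV /= sC.
have a0 : s = 0 -> a = 0.
  by move=> s0; apply: b_eq0; rewrite -ss s0 mul0r.
(* [Q] projects orthogonally to the row [a], so the Gram matrix of [A' *m Q] is the Schur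
   complement. If [b = 0] then [a = 0], and the convention [0^-1 = 0] yields [Q = 1] and [v = 0]. *)
pose Q : 'M[F]_k := 1%:M - b^-1 *: (a ^t* *m a).
have bC : b^-1^* = b^-1 by apply/CrealP; rewrite rpredV ger0_real.
have QC : Q ^t* = Q.
  apply/matrixP => i j; rewrite trmxCE !mxE rmorphB rmorphM rmorph_nat /= bC.
  rewrite rmorph_sum eq_sym; congr (_ - _ * _); apply: eq_bigr => l _.
  by rewrite !mxE rmorphM /= conjCK mulrC.
have QQ : Q *m Q ^t* = Q.
  rewrite QC mulmxBl mul1mx -[RHS]subr0; congr (_ - _).
  rewrite mulmxBr mulmx1 -!scalemxAl -!scalemxAr -!mulmxA (mulmxA a) aaE.
  rewrite mul_scalar_mx -!scalemxAr !scalerA.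
  have [/eqP|b0] := eqVneq b 0; first by move/eqP->; rewrite invr0 !mul0r scale0r subrr.
  by rewrite mulVf // mulr1 subrr.
have AAE : A *m A ^t* = block_mx (s * s)%:M (s *: v ^t*) (s *: v)
    (v *m v ^t* + (A' *m Q) *m (A' *m Q) ^t*).
  rewrite {1 2}defA tr_col_mx map_row_mx mul_col_row.
  have [s0|s0] := eqVneq s 0.
    have a00 := a0 s0.
    rewrite /v /Q a00 /= s0 invr0 !scale0r mulr0 !trmx0 !map_mx0 !mul0mx !mulmx0.
    by rewrite add0r scaler0 subr0 mulmx1 raddf0.
  have sv : s *: v = A' *m a ^t* by rewrite scalerA mulfV // scale1r.
  congr block_mx => //; first by rewrite aaE ss.
    have -> : s *: v ^t* = (s *: v) ^t*.
      by apply/matrixP => i j; rewrite mxE !trmxCE [in RHS]mxE rmorphM /= sC.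
    by rewrite sv trmxC_mul trmxCK.
  rewrite trmxC_mul -mulmxA (mulmxA Q) QQ mulmxBl mulmxBr mul1mx.
  rewrite addrC -[LHS]subr0 -addrA; congr (_ + _); rewrite addrC; apply/esym/eqP.
  rewrite oppr0 subr_eq0; apply/eqP.
  have -> : v ^t* = s^-1 *: (a *m A' ^t*).
    apply/matrixP => i j; rewrite trmxCE mxE [in RHS]mxE rmorphM /= sVC.
    by congr (_ * _); rewrite -trmxCE trmxC_mul trmxCK.
  rewrite /v -!scalemxAl -!scalemxAr scalerA -invfM ss.
  by rewrite !mulmxA.
have vE n : v n 0 != 0 -> E (rshift 1 n) (lshift N 0).
  move=> vn0; apply: EA; rewrite AAE block_mxEdl mxE mulf_neq0 //.
  by apply: contra vn0 => /eqP s0; rewrite mxE s0 invr0 mul0r.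
have [||| L [LL Ltrig LE Lcol]] :=
    IH (A' *m Q) (fun n m => E (rshift 1 n) (rshift 1 m)).
- by move=> n; apply: Erefl.
- move=> m n p mn mp; apply: Echord; by rewrite /= ltn_add2l.
(* Subtracting [v *m v ^t*] can fill the entry [(n, m)] only if both indices are neighbours of the
   eliminated one; chordality then supplies the edge. *)
- move=> n m; apply: contraR => nE; have /eqP : (A *m A ^t*) (rshift 1 n) (rshift 1 m) = 0.
    by apply/eqP; apply: contraR nE; apply: EA.
  rewrite AAE block_mxEdr mxE.
  suff -> : (v *m v ^t*) n m = 0 by rewrite add0r => ->.
  rewrite mxE big_ord_recl big_ord0 addr0 trmxCE; apply/eqP; rewrite mulf_eq0 conjC_eq0.
  apply: contraR nE; rewrite negb_or => /andP[/vE En /vE Em].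
  by apply: Echord En Em.
exists (block_mx s%:M 0 v L); split.
- rewrite AAE tr_block_mx map_block_mx mulmx_block !tr_scalar_mx !map_scalar_mx.
  rewrite !trmx0 !map_mx0 !mul0mx !mulmx0 !addr0 LL -scalar_mxM /= sC.
  by rewrite mul_scalar_mx mul_mx_scalar.
- move=> n m; case: (split_ordP n) => i ->; case: (split_ordP m) => j -> /=.
  + by rewrite !ord1.
  + by rewrite block_mxEur mxE.
  + by rewrite (ord1 j).
  + by rewrite ltn_add2l block_mxEdr => /Ltrig.
- move=> n m; case: (split_ordP n) => i ->; case: (split_ordP m) => j ->.
  + by rewrite !ord1 => _; apply: Erefl.
  + by rewrite block_mxEur mxE eqxx.
  + by rewrite (ord1 j) block_mxEdl => /vE.
  + by rewrite block_mxEdr => /LE.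
- move=> m; case: (split_ordP m) => j ->.
    rewrite (ord1 j) block_mxEul mxE mulr1n => s0 n.
    case: (split_ordP n) => i ->; first by rewrite block_mxEul ord1 mxE s0 mul0rn.
    by rewrite block_mxEdl mxE s0 invr0 mul0r.
  rewrite block_mxEdr => /Lcol Lj n.
  by case: (split_ordP n) => i ->; rewrite ?block_mxEur ?block_mxEdr ?mxE.
Qed.

(** After unitary diagonalisation, take [t = - 1 / lambda] for an eigenvalue [lambda] of largest
    modulus. All the numbers [1 + t * lambda_j] are then nonnegative, one is zero, and their square
    roots give [A]. *)
Lemma singular_shift_gram N (H : 'M[F]_N) : H ^t* = H -> H != 0 ->
  exists (t : F) (A : 'M[F]_N),
    A *m A ^t* = 1%:M + t *: H /\ \det A = 0.
Proof.
move=> HC H0.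
have Hh : H \is hermsymmx.
  by apply/is_hermitianmxP; rewrite expr0 scale1r HC.
have /mxOverP sp_real := hermitian_spectral_diag_real Hh.
have /orthomx_spectralP HE := hermitian_normalmx Hh.
have Pu := spectral_unitarymx H.
set P := spectralmx H in HE Pu; set sp := spectral_diag H in HE sp_real.
rewrite (invmx_unitary Pu) in HE.
have [i0 spi0] : exists i, sp 0 i != 0.
  apply/existsP; apply: contraR H0; rewrite negb_exists => /forallP sp0.
  suff sp00 : sp = 0 by rewrite HE sp00 raddf0 mulmx0 mul0mx.
  by apply/rowP => i; rewrite mxE; apply/eqP; move: (sp0 i); rewrite negbK.
have [i _ imax] : extremum_spec >=%R xpredT (fun i => `|sp 0 i|)
    [arg max_(i > i0) `|sp 0 i|]%O by apply: real_arg_maxP => // j _; apply: normr_real.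
have spi : sp 0 i != 0.
  by rewrite -normr_gt0; apply: lt_le_trans (imax i0 isT); rewrite normr_gt0.
pose t := - (sp 0 i)^-1.
pose d : 'rV[F]_N := \row_j sqrtC (1 + t * sp 0 j).
have d_ge0 j : 0 <= 1 + t * sp 0 j.
  rewrite /t mulNr subr_ge0; apply: le_trans (real_ler_norm _) _.
    by rewrite rpredM // ?rpredV sp_real.
  by rewrite normrM normfV mulrC ler_pdivrMr ?normr_gt0 // mul1r; apply: imax.
exists t, (P ^t* *m diag_mx d); split.
  have PP : P ^t* *m P = 1%:M.
    by apply: mulmx1C; apply/unitarymxP.
  rewrite trmxC_mul trmxCK tr_diag_mx map_diag_mx -mulmxA (mulmxA (diag_mx d)) mulmx_diag.
  have -> : 1%:M + t *: H = P ^t* *m ((1%:M + t *: diag_mx sp) *m P).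
    by rewrite mulmxDl mulmxDr mul1mx PP -scalemxAl -scalemxAr mulmxA -HE.
  congr (_ *m (_ *m _)).
  apply/matrixP => j l; rewrite !mxE; case: eqP => [_|_]; last by rewrite !mulr0n mulr0 addr0.
  rewrite !mulr1n /= geC0_conj ?sqrtC_ge0 //.
  by rewrite -expr2 sqrtCK.
rewrite det_mulmx det_diag (bigD1 i) //= mxE /t mulNr mulVf // subrr sqrtC0.
by rewrite mul0r mulr0.
Qed.

Lemma exists_dependency (I J : finType) (P : pred I) (Q : pred J) (a : I -> J -> F) :
  (#|Q| < #|P|)%N ->
  exists h : I -> F, [/\ exists i, h i != 0, forall i, ~~ P i -> h i = 0 &
    forall j, Q j -> \sum_i h i * a i j = 0].
Proof.
move=> ltQP; pose A : 'M[F]_(#|P|, #|Q|) := \matrix_(i, j) a (enum_val i) (enum_val j).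
have : kermx A != 0.
  rewrite kermx_eq0 -row_leq_rank -ltnNge.
  exact: leq_ltn_trans (rank_leq_col A) ltQP.
case/rowV0Pn => w /sub_kermxP wA w0.
have [k wk] : exists k, w 0 k != 0.
  apply/existsP; apply: contraR w0; rewrite negb_exists => /forallP w0.
  by apply/eqP/rowP => i; rewrite mxE; apply/eqP; move: (w0 i); rewrite negbK.
have Pk : P (enum_val k) := enum_valP k.
pose h i := if P i then w 0 (enum_rank_in Pk i) else 0.
exists h; split.
- by exists (enum_val k); rewrite /h Pk enum_valK_in.
- by move=> i /negbTE; rewrite /h => ->.
move=> j Qj; have /rowP /(_ (enum_rank_in Qj j)) := wA.
rewrite !mxE => wAj; rewrite -[RHS]wAj (bigID P) /= [X in _ + X]big1 ?addr0; last first.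
  by move=> i /negbTE nPi; rewrite /h nPi mul0r.
rewrite (eq_bigl [in P]) // big_enum_val; apply: eq_bigr => l _; rewrite mxE enum_rankK_in //.
by rewrite /h (enum_valP l : P _) enum_valK_in.
Qed.

End LinearAlgebra.

(** * Choi matrices and canonical Kraus families *)

Section KrausReduction.
Variable F : numClosedFieldType.

Definition choi d N (K : 'I_N -> 'M[F]_d) (x j y k : 'I_d) : F :=
  \sum_n K n x j * (K n y k)^*.

Definition line (f : {ffun 'I_3 -> 'I_3}) : 'I_3 * 'I_3 := (f 1, f ord_max).

Lemma eq_line (f g : {ffun 'I_3 -> 'I_3}) j :
  line f = line g -> j != 0 -> f j = g j.
Proof.
move=> [fg1 fg2]; case: j => [[|[|[|]]]] //= lt_j _.
  by have -> : Ordinal lt_j = 1 by apply: val_inj.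
by have -> : Ordinal lt_j = ord_max by apply: val_inj.
Qed.

Lemma line_inj (f g : {ffun 'I_3 -> 'I_3}) :
  line f = line g -> f 0 = g 0 -> f = g.
Proof.
move=> fg fg0; apply/ffunP => j; have [->//|] := eqVneq j 0.
exact: eq_line.
Qed.

(* [f n] records the row of the possibly nonzero entry in each column of [K n];
   only the operators marked by [tg] may have a nonzero first column. *)
Record canonical N (f : 'I_N -> {ffun 'I_3 -> 'I_3}) (tg : pred 'I_N)
    (K : 'I_N -> 'M[F]_3) : Prop := Canonical {
  canonical_supp : forall n x j, K n x j != 0 -> x = f n j;
  canonical_col0 : forall n x, K n x 0 != 0 -> tg n;
  canonical_tg : forall m n : 'I_N, (m <= n)%N -> tg n -> tg m;
  canonical_inj : forall m n, tg m -> tg n -> f m = f n -> m = n }.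

(** Operators on one line allow the same rows in columns 1 and 2. Excluding pairs of distinct marked
    operators prevents a mixed first column from having two nonzero entries. *)
Definition mixable N (f : 'I_N -> {ffun 'I_3 -> 'I_3}) (tg : pred 'I_N) : rel 'I_N :=
  fun n m => (line (f n) == line (f m)) && [|| n == m, ~~ tg n | ~~ tg m].

(** * Counting mixing parameters against Choi entries *)

(** The right side minus the left is [r^2 + (2k - 7) r + 18 - 6k]. For [k = 3] it is [r (r - 1)], so
    18 is the best constant for slope 7; for [k < 3] its discriminant is negative. *)
Lemma leq_block k r : (k <= 3)%N ->
  (7 * (k + r) <= 18 + (k * (1 + r) + r * (k + r)))%N.
Proof.
have [r7 k3|] := leqP 7 r; last first.
  by case: k r => [|[|[|[|]]]] // [|[|[|[|[|[|[|]]]]]]].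
have : (7 * r <= r * r)%N by rewrite leq_mul2r r7 orbT.
by lia.
Qed.

(** Marked operators on one line differ in [f n 0], so there are at most 3 of them. Summing
    [leq_block] over the 9 lines gives 162 = 9 * 18. *)
Lemma card_mixable N (f : 'I_N -> {ffun 'I_3 -> 'I_3}) (tg : pred 'I_N) :
  (forall m n, tg m -> tg n -> f m = f n -> m = n) ->
  (7 * N <= 162 + #|[pred e : 'I_N * 'I_N | mixable f tg e.1 e.2]|)%N.
Proof.
move=> tg_inj.
pose k l := (\sum_(n | (line (f n) == l) && tg n) 1)%N.
pose r l := (\sum_(n | (line (f n) == l) && ~~ tg n) 1)%N.
have NE : N = (\sum_l (k l + r l))%N.
  rewrite -[N in LHS]card_ord -sum1_card (partition_big (fun n => line (f n)) xpredT) //=.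
  by apply: eq_bigr => l _; rewrite (bigID tg).
have k_le3 l : (k l <= 3)%N.
  rewrite /k sum1dep_card -[X in (_ <= X)%N](card_ord 3).
  rewrite -(card_in_imset (f := fun n => f n 0)) ?max_card // => m n.
  rewrite !inE => /andP[/eqP lm tm] /andP[/eqP ln tn] mn.
  by apply: tg_inj => //; apply: line_inj => //; rewrite lm ln.
have row_tg n : tg n -> (\sum_(m | mixable f tg n m) 1 = 1 + r (line (f n)))%N.
  move=> tn; rewrite (bigD1 n) /=; last by rewrite /mixable !eqxx.
  congr (_ + _)%N; apply: eq_bigl => m; rewrite /mixable tn /= (eq_sym (line (f n))) (eq_sym m n).
  have [<-|nm] := eqVneq n m; first by rewrite tn !andbF.
  by rewrite andbT.
have row_ntg n : ~~ tg n ->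
    (\sum_(m | mixable f tg n m) 1 = k (line (f n)) + r (line (f n)))%N.
  move=> tn; rewrite (bigID tg) /=; congr (_ + _)%N; apply: eq_bigl => m;
    by rewrite /mixable tn orbT andbT eq_sym.
have EE : #|[pred e : 'I_N * 'I_N | mixable f tg e.1 e.2]|
    = (\sum_l (k l * (1 + r l) + r l * (k l + r l)))%N.
  rewrite -sum1_card -(pair_big_dep xpredT (mixable f tg) (fun _ _ => 1%N)) /=.
  rewrite (partition_big (fun n => line (f n)) xpredT) //=.
  apply: eq_bigr => l _; rewrite (bigID tg) /=; congr (_ + _)%N.
    rewrite /k big_distrl /=; apply: eq_bigr => n /andP[/eqP <- tn].
    by rewrite mul1n row_tg.
  rewrite {2}/r big_distrl /=; apply: eq_bigr => n /andP[/eqP <- tn].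
  by rewrite mul1n row_ntg.
rewrite EE {1}NE big_distrr /=.
have -> : 162%N = (\sum_(l : 'I_3 * 'I_3) 18)%N.
  by rewrite sum_nat_const card_prod !card_ord.
rewrite -big_split /=; apply: leq_sum => l _.
exact: leq_block.
Qed.

(** With one nonzero entry per column, Choi entries with equal columns and different rows vanish.
    This excludes 3 * 6 = 18 of the 81 entries. *)
Definition choi_support : pred (('I_3 * 'I_3) * ('I_3 * 'I_3)) :=
  fun z => (z.1.2 != z.2.2) || (z.1.1 == z.2.1).

Lemma card_choi_support : #|choi_support| = 63.
Proof.
have supportE (x j y k : 'I_3) :
    choi_support ((x, j), (y, k)) = (j != k) || (x == y) by [].
rewrite -sum1_card big_mkcond /=.
rewrite -(pair_bigA _ (fun a b => if choi_support (a, b) then 1 else 0)%N).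
rewrite -(pair_bigA _ (fun x j => \sum_b if choi_support ((x, j), b) then 1 else 0)%N) /=.
rewrite (eq_bigr (fun _ => 21%N)) => [|x _]; first by rewrite sum_nat_const card_ord.
rewrite (eq_bigr (fun _ => 7%N)) => [|j _]; first by rewrite sum_nat_const card_ord.
rewrite -(pair_bigA _ (fun y k => if choi_support ((x, j), (y, k)) then 1 else 0)%N) /=.
rewrite !big_ord_recl !big_ord0 !supportE.
by case: x => [[|[|[|]]]] //; case: j => [[|[|[|]]]].
Qed.

(** For [M = L *m L ^t*] this is the Choi matrix of the family mixed by [L], see [choi_mix].
    Allowing any [M] makes the conditions on it linear. *)
Definition gram_choi d N (K : 'I_N -> 'M[F]_d) (M : 'M[F]_N) (x j y k : 'I_d) : F :=
  \sum_n \sum_m M n m * (K n x j * (K m y k)^*).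

Lemma gram_choi_linear d N (K : 'I_N -> 'M[F]_d) t (A B : 'M[F]_N) x j y k :
  gram_choi K (A + t *: B) x j y k
    = gram_choi K A x j y k + t * gram_choi K B x j y k.
Proof.
rewrite /gram_choi mulr_sumr -big_split /=; apply: eq_bigr => n _.
rewrite mulr_sumr -big_split /=; apply: eq_bigr => m _.
by rewrite !mxE mulrDl -mulrA.
Qed.

Lemma gram_choi1 d N (K : 'I_N -> 'M[F]_d) x j y k :
  gram_choi K 1%:M x j y k = choi K x j y k.
Proof.
rewrite /gram_choi /choi; apply: eq_bigr => n _; rewrite (bigD1 n) //= mxE eqxx mul1r big1 ?addr0 //.
by move=> m; rewrite mxE eq_sym => /negbTE ->; rewrite mul0r.
Qed.

Lemma gram_choiC d N (K : 'I_N -> 'M[F]_d) (M : 'M[F]_N) x j y k :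
  gram_choi K (M ^t*) x j y k = (gram_choi K M y k x j)^*.
Proof.
rewrite /gram_choi rmorph_sum exchange_big /=; apply: eq_bigr => n _.
rewrite rmorph_sum; apply: eq_bigr => m _.
by rewrite trmxCE !rmorphM /= conjCK; congr (_ * _); rewrite mulrC.
Qed.

Lemma choi_mix d N (K : 'I_N -> 'M[F]_d) (L : 'M[F]_N) x j y k :
  choi (fun m => \sum_n L n m *: K n) x j y k = gram_choi K (L *m L ^t*) x j y k.
Proof.
have entry m a b : (\sum_n L n m *: K n) a b = \sum_n L n m * K n a b.
  by rewrite summxE; apply: eq_bigr => n _; rewrite mxE.
transitivity (\sum_m \sum_n \sum_p L n m * (L p m)^* * (K n x j * (K p y k)^*)).
  rewrite /choi; apply: eq_bigr => m _; rewrite !entry rmorph_sum mulr_suml; apply: eq_bigr => n _.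
  rewrite mulr_sumr; apply: eq_bigr => p _; rewrite rmorphM /=; ring.
rewrite exchange_big /gram_choi; apply: eq_bigr => n _ /=.
rewrite exchange_big; apply: eq_bigr => p _ /=.
by rewrite mxE mulr_suml; apply: eq_bigr => m _; rewrite trmxCE.
Qed.

(** The unknowns are the entries of [M] at mixable pairs, at least 7 * 33 - 162 = 69 of them,
    against 63 equations. *)
Lemma exists_mixable_deformation N (f : 'I_N -> {ffun 'I_3 -> 'I_3}) tg
    (K : 'I_N -> 'M[F]_3) :
    canonical f tg K -> (32 < N)%N ->
  exists H : 'M[F]_N, [/\ H ^t* = H, H != 0,
    forall n m, H n m != 0 -> mixable f tg n m &
    forall x j y k, gram_choi K H x j y k = 0].
Proof.
move=> canK N32.
have mixS n m : mixable f tg n m = mixable f tg m n.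
  by rewrite /mixable eq_sym (eq_sym n) [~~ tg n || _]orbC.
pose E := [pred e : 'I_N * 'I_N | mixable f tg e.1 e.2].
have ltE : (#|choi_support| < #|E|)%N.
  have := card_mixable (canonical_inj canK); rewrite card_choi_support -/E.
  by move: #|E| => e; lia.
have [h [[[n0 m0] h0] hE hK]] := exists_dependency (fun (e : 'I_N * 'I_N) z =>
  K e.1 z.1.1 z.1.2 * (K e.2 z.2.1 z.2.2)^*) ltE.
pose M : 'M[F]_N := \matrix_(n, m) h (n, m).
have ME n m : M n m != 0 -> mixable f tg n m.
  by rewrite mxE; apply: contraR => /(hE (n, m)) ->.
have M0 : M != 0.
  by apply: contra_neq h0 => /matrixP /(_ n0 m0); rewrite !mxE.
have MK x j y k : gram_choi K M x j y k = 0.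
  have [zS|] := boolP (choi_support ((x, j), (y, k))).
    rewrite -[RHS](hK _ zS) /gram_choi pair_bigA /=.
    by apply: eq_bigr => -[n m] _; rewrite mxE.
  (* Entries outside the support vanish by mixability: in columns 1 and 2 the rows agree along a
     line, and in column 0 both operators are marked, which forces [n = m]. *)
  rewrite negb_or negbK /= => /andP[/eqP <- xy].
  rewrite /gram_choi big1 // => n _; rewrite big1 // => m _.
  apply/eqP; rewrite !mulf_eq0 conjC_eq0; apply: contraR xy.
  rewrite !negb_or => /and3P[/ME /andP[/eqP lnm tnm] Kn Km].
  rewrite (canonical_supp canK Kn) (canonical_supp canK Km).
  have [j0|/(eq_line lnm) -> //] := eqVneq j 0.
  rewrite j0 in Kn Km.
  move: tnm; rewrite (canonical_col0 canK Kn) (canonical_col0 canK Km) !orbF.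
  by move/eqP->.
have MCE n m : (M ^t*) n m != 0 -> mixable f tg n m.
  by rewrite trmxCE conjC_eq0 mixS => /ME.
(* The solution [M] need not be Hermitian. If [M + M ^t*] is zero, then [M] is skew-Hermitian and
   ['i *: M] is Hermitian. *)
have [MC|MC] := eqVneq (M + M ^t*) 0.
  have MCN : M ^t* = - M by apply/eqP; rewrite -addr_eq0 addrC MC.
  exists ('i *: M); split.
  - apply/matrixP => n m; rewrite trmxCE !mxE rmorphM /= conjCi.
    have /matrixP /(_ n m) := MCN; rewrite trmxCE !mxE => ->.
    by rewrite mulrNN.
  - by rewrite scaler_eq0 negb_or neq0Ci.
  - by move=> n m; rewrite mxE mulf_eq0 negb_or => /andP[_ /ME].
  - move=> x j y k; rewrite -[_ *: _]add0r gram_choi_linear MK mulr0 addr0.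
    by rewrite /gram_choi big1 // => n _; rewrite big1 // => m _; rewrite mxE mul0r.
exists (M + M ^t*); split=> //.
- by apply/matrixP => n m; rewrite trmxCE [in LHS]mxE [in RHS]mxE rmorphD /= !trmxCE conjCK addrC.
- move=> n m; apply: contraR => nE.
  rewrite mxE.
  have -> : M n m = 0 by apply/eqP; apply: contraR nE; apply: ME.
  have -> : (M ^t*) n m = 0 by apply/eqP; apply: contraR nE; apply: MCE.
  by rewrite addr0.
- move=> x j y k; rewrite -[M ^t*]scale1r gram_choi_linear MK gram_choiC MK.
  by rewrite rmorph0 mulr0 addr0.
Qed.

(** * Removal of one operator and descent to 32 *)

Lemma canonical_reduce N (f : 'I_N.+1 -> {ffun 'I_3 -> 'I_3}) tg
    (K : 'I_N.+1 -> 'M[F]_3) :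
    canonical f tg K -> (32 < N.+1)%N ->
  exists f' tg' (K' : 'I_N -> 'M[F]_3), canonical f' tg' K' /\
    forall x j y k, choi K' x j y k = choi K x j y k.
Proof.
move=> canK N32.
have [H [HC H0 HE HK]] := exists_mixable_deformation canK N32.
have [t [A [AE detA]]] := singular_shift_gram HC H0.
have tgm (m n : 'I_N.+1) : (m <= n)%N -> tg n -> tg m by apply: (canonical_tg canK).
have [|||L [LE Ltrig Lmix Lcol]] := chordal_cholesky (A := A) (E := mixable f tg).
- by move=> n; rewrite /mixable !eqxx.
(* Marked indices come first, so a later neighbour [n] of [m] is unmarked: otherwise [m] would be
   marked too, and mixability would give [n = m]. *)
- move=> m n p mn mp /andP[/eqP lnm nm] /andP[/eqP lpm pm].
  rewrite /mixable lnm lpm eqxx /=.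
  have [tn|//] := boolP (tg n); last by rewrite orbT.
  have tm := tgm _ _ (ltnW mn) tn.
  by move: nm; rewrite tn tm !orbF => /eqP nm; rewrite nm ltnn in mn.
- move=> n m; rewrite AE !mxE; have [->|nm] := eqVneq n m.
    by rewrite /mixable !eqxx.
  by rewrite mulr0n add0r mulf_eq0 negb_or => /andP[_ /HE].
have detL : \det L = 0.
  have /eqP : \det (L *m L ^t*) = 0 by rewrite -LE det_mulmx detA mul0r.
  by rewrite det_mulmx det_map_mx det_tr mulf_eq0 conjC_eq0 orbb => /eqP.
have [m Lm] : exists m, L m m = 0.
  move/eqP: detL; rewrite det_trig; last by apply/is_trig_mxP.
  by move/prodf_eq0 => [m _ /eqP]; exists m.
pose K2 m := \sum_n L n m *: K n.
(* Triangularity gives [p <= n]. If [K n] has a nonzero first column, then [p] is marked as well,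
   and mixability forces [n = p]; hence [f] and [tg] stay valid for the mixed family. *)
have K2nz p x j : K2 p x j != 0 -> exists n : 'I_N.+1,
    [/\ (p <= n)%N, mixable f tg n p & K n x j != 0].
  move=> K2p; have /existsP[n] : [exists n, L n p * K n x j != 0].
    apply: contraR K2p; rewrite negb_exists => /forallP LK0.
    rewrite summxE big1 // => n _; rewrite mxE; apply/eqP.
    by move: (LK0 n); rewrite negbK.
  rewrite mulf_eq0 negb_or => /andP[Lnp Knx]; exists n; split=> //; last exact: Lmix.
  by rewrite leqNgt; apply: contra Lnp => /Ltrig ->.
exists (fun i => f (lift m i)), (fun i => tg (lift m i)), (fun i => K2 (lift m i)).
split; last first.
  move=> x j y k; rewrite -[RHS]gram_choi1 -[RHS]addr0 -[X in _ + X](mulr0 t).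
  rewrite -(HK x j y k) -gram_choi_linear -AE LE -choi_mix /choi [RHS](bigD1_ord m) //=.
  by rewrite summxE [X in X * _]big1 ?mul0r ?add0r // => n _; rewrite mxE Lcol // mul0r.
split.
- move=> i x j /K2nz[n [in_le /andP[/eqP lni tni] Knx]].
  rewrite (canonical_supp canK Knx).
  have [j0|/(eq_line lni) -> //] := eqVneq j 0.
  rewrite j0 in Knx; have tn := canonical_col0 canK Knx.
  by move: tni; rewrite tn (tgm _ _ in_le tn) !orbF => /eqP ->.
- move=> i x /K2nz[n [in_le _ Knx]].
  exact: tgm in_le (canonical_col0 canK Knx).
- by move=> i p ip; apply: tgm; rewrite /= leq_bump2.
- by move=> i p ti tp /(canonical_inj canK ti tp) /lift_inj.
Qed.

Lemma canonical_le32 N (f : 'I_N -> {ffun 'I_3 -> 'I_3}) tg (K : 'I_N -> 'M[F]_3) :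
    canonical f tg K ->
  exists N' (f' : 'I_N' -> {ffun 'I_3 -> 'I_3}) tg' (K' : 'I_N' -> 'M[F]_3),
    [/\ (N' <= 32)%N, canonical f' tg' K' &
        forall x j y k, choi K' x j y k = choi K x j y k].
Proof.
elim: N f tg K => [|N IH] f tg K canK; first by exists 0, f, tg, K.
have [N32|N32] := leqP N.+1 32; first by exists N.+1, f, tg, K.
have [f' [tg' [K' [/IH[N'' [f'' [tg'' [K'' [leN can'' K''E]]]]] K'E]]]] :=
  canonical_reduce canK N32.
by exists N'', f'', tg'', K''; split=> // x j y k; rewrite K''E.
Qed.

(** * Construction of a canonical family *)

(** The operators with [f n = g] enter the Choi matrix only through the Gram matrix of their column
    entries. Its lower triangular Cholesky factor replaces them by three operators, of which only
    the first may have a nonzero first column. *)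
Lemma canonical_exists N (f : 'I_N -> {ffun 'I_3 -> 'I_3}) (K : 'I_N -> 'M[F]_3) :
    (forall n x j, K n x j != 0 -> x = f n j) ->
  exists N' (f' : 'I_N' -> {ffun 'I_3 -> 'I_3}) tg' (K' : 'I_N' -> 'M[F]_3),
    canonical f' tg' K' /\ forall x j y k, choi K' x j y k = choi K x j y k.
Proof.
move=> suppK; pose T := {ffun 'I_3 -> 'I_3}.
pose A (g : T) : 'M[F]_(3, N) := \matrix_(j, n) (if f n == g then K n (g j) j else 0).
have /fin_all_exists[L LP] (g : T) : exists L : 'M[F]_3,
    A g *m (A g) ^t* = L *m L ^t* /\ forall n m : 'I_3, (n < m)%N -> L n m = 0.
  have [//|//|//|L [? ? _ _]] := chordal_cholesky (A := A g) (E := fun _ _ => true).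
  by exists L.
pose op (g : T) m : 'M[F]_3 := \matrix_(x, j) (if x == g j then L g j m else 0).
have op_supp g m x j : op g m x j != 0 -> x = g j.
  by rewrite mxE; case: (x =P g j) => // _; rewrite eqxx.
(* The first 27 indices carry the marked operators [op g 0], the other 54 carry [op g 1] and
   [op g 2], so that marked operators come first. *)
pose f' (n : 'I_(#|{: T}| + #|{: T * 'I_2}|)) : T :=
  match split n with inl i => enum_val i | inr i => (enum_val i).1 end.
pose K' (n : 'I_(#|{: T}| + #|{: T * 'I_2}|)) : 'M[F]_3 :=
  match split n with
  | inl i => op (enum_val i) 0
  | inr i => op (enum_val i).1 (lift 0 (enum_val i).2)
  end.
exists _, f', (fun n => n < #|{: T}|)%N, K'; split.
  split.
  - by move=> n x j; rewrite /K' /f'; case: (split n) => i /op_supp.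
  - move=> n x; rewrite -[n]splitK /K' unsplitK; case: (split n) => i //=.
    rewrite mxE (LP _).2 //.
    by case: ifP; rewrite eqxx.
  - by move=> m n; apply: leq_ltn_trans.
  - move=> m n; rewrite -[m]splitK -[n]splitK /f' !unsplitK.
    case: (split m) => i; case: (split n) => p /=;
      rewrite ?[(_ + _ < _)%N]ltnNge ?leq_addr // => _ _.
    by move/enum_val_inj ->.
move=> x j y k.
transitivity (\sum_g \sum_m op g m x j * (op g m y k)^*).
  rewrite /choi big_split_ord /=.
  under eq_bigr => i _ do rewrite /K' (unsplitK (inl i)).
  under [X in _ + X]eq_bigr => i _ do rewrite /K' (unsplitK (inr i)).
  rewrite -(big_enum_val (fun g => op g 0 x j * (op g 0 y k)^*)).
  rewrite -(big_enum_val (fun z : T * 'I_2 =>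
    op z.1 (lift 0 z.2) x j * (op z.1 (lift 0 z.2) y k)^*)) /=.
  rewrite -(pair_bigA _ (fun g m => op g (lift 0 m) x j * (op g (lift 0 m) y k)^*)) /=.
  by rewrite -big_split /=; apply: eq_bigr => g _; rewrite [RHS]big_ord_recl.
transitivity (\sum_(g : T) \sum_n
    if (x == g j) && (y == g k) then A g j n * (A g k n)^* else 0).
  apply: eq_bigr => g _; have [/andP[xg yg]|xy] := boolP ((x == g j) && (y == g k)).
    have /matrixP /(_ j k) := (LP g).1; rewrite !mxE => LAE.
    transitivity (\sum_m L g j m * (L g ^t*) m k).
      by apply: eq_bigr => m _; rewrite !mxE xg yg.
    by rewrite -LAE; apply: eq_bigr => n _; rewrite trmxCE.
  rewrite [RHS]big1 // big1 // => m _; rewrite !mxE.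
  move: xy; case: (x == g j) => /= [/negbTE ->|_]; last by rewrite mul0r.
  by rewrite rmorph0 mulr0.
rewrite exchange_big; apply: eq_bigr => n _ /=.
rewrite (bigD1 (f n)) //= big1 ?addr0; last first.
  move=> g gf; by rewrite !mxE [f n == g]eq_sym (negbTE gf) mul0r; case: ifP.
rewrite !mxE eqxx.
case: ifP => [/andP[/eqP -> /eqP ->]//|xy].
apply/esym/eqP; rewrite mulf_eq0 conjC_eq0; apply: contraFT xy.
by rewrite negb_or => /andP[/suppK -> /suppK ->]; rewrite !eqxx.
Qed.

End KrausReduction.

(** * Incoherent Kraus operators and the qutrit bound *)

Lemma adjointE d (A : 'M[C]_d) i j : adjoint A i j = (A j i)^*.
Proof. by rewrite !mxE. Qed.

Lemma kraus_entry d (K rho : 'M[C]_d) x y :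
  (K *m rho *m adjoint K) x y = \sum_j \sum_k rho j k * (K x j * (K y k)^*).
Proof.
rewrite mxE exchange_big; apply: eq_bigr => k _; rewrite mxE mulr_suml.
by apply: eq_bigr => j _; rewrite adjointE mulrAC mulrC mulrA.
Qed.

Lemma incoherent_kraus_supp d (K : 'M[C]_d) (f : 'I_d -> 'I_d) :
  (forall x j, K x j != 0 -> x = f j) -> incoherent_kraus K.
Proof.
move=> suppK delta [delta_diag [delta_ge0 _]] tr0.
set M := K *m delta *m adjoint K in tr0 *.
have ME x y : M x y = \sum_j delta j j * (K x j * (K y j)^*).
  rewrite kraus_entry; apply: eq_bigr => j _; rewrite (bigD1 j) //= big1 ?addr0 //.
  by move=> k kj; rewrite delta_diag 1?eq_sym // mul0r.
have M_ge0 x : 0 <= M x x.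
  by rewrite ME sumr_ge0 // => j _; rewrite mulr_ge0 // mul_conjC_ge0.
split; [|split].
- move=> x y xy; rewrite mxE ME big1 ?mulr0 // => j _.
  apply/eqP; rewrite !mulf_eq0 conjC_eq0; apply: contraR xy.
  by rewrite !negb_or => /and3P[_ /suppK -> /suppK ->].
- by move=> x; rewrite mxE mulr_ge0 // invr_ge0 sumr_ge0.
- by rewrite mxtraceZ mulVf.
Qed.

(** The basis state at [j] has an image with entries [K x j * (K y j)^*], which must vanish off the
    diagonal. *)
Lemma incoherent_kraus_inj d (K : 'M[C]_d) j x y :
  incoherent_kraus K -> K x j != 0 -> K y j != 0 -> x = y.
Proof.
move=> incK Kx Ky; apply/eqP; apply: contraT => xy.
pose delta : 'M[C]_d := delta_mx j j.
have KE a b : (K *m delta *m adjoint K) a b = K a j * (K b j)^*.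
  rewrite kraus_entry (bigD1 j) //= (bigD1 j) //= [X in _ + X + _]big1; last first.
    by move=> k kj; rewrite mxE (negbTE kj) andbF mul0r.
  rewrite [X in _ + X]big1 ?addr0; last first.
    by move=> i ij; rewrite big1 // => k _; rewrite mxE (negbTE ij) mul0r.
  by rewrite mxE !eqxx mul1r.
have delta_inc : incoherent_state delta.
  split; [|split].
  - move=> a b ab; rewrite mxE; case: eqP => [aj|//].
    by case: eqP => [bj|//]; rewrite aj bj eqxx in ab.
  - by move=> a; rewrite mxE ler0n.
  - rewrite /mxtrace (bigD1 j) //= mxE !eqxx big1 ?addr0 // => a aj.
    by rewrite mxE (negbTE aj).
have tr_neq0 : \tr (K *m delta *m adjoint K) != 0.
  rewrite psumr_neq0; last by move=> a _; rewrite KE mul_conjC_ge0.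
  by apply/hasP; exists x; rewrite ?mem_index_enum //= KE mul_conjC_gt0.
have [/(_ x y xy) + _] := incK _ delta_inc tr_neq0.
move/eqP; rewrite mxE KE mulf_eq0 invr_eq0 (negbTE tr_neq0) mulf_eq0 conjC_eq0.
by rewrite (negbTE Kx) (negbTE Ky).
Qed.

Lemma incoherent_kraus_fun d (K : 'M[C]_d) : incoherent_kraus K ->
  exists f : {ffun 'I_d -> 'I_d}, forall x j, K x j != 0 -> x = f j.
Proof.
move=> incK; exists [ffun j => odflt j [pick x | K x j != 0]] => x j Kx.
rewrite ffunE; case: pickP => [y Ky|/(_ x)]; last by rewrite Kx.
exact: incoherent_kraus_inj Kx Ky.
Qed.

(** The action of the map and the trace-preservation sum are both linear in the Choi entries. *)
Lemma eq_choi_kraus_rep d N N' (Phi : 'M[C]_d -> 'M[C]_d) (Ks : 'I_N -> 'M[C]_d)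
    (Ks' : 'I_N' -> 'M[C]_d) :
    incoherent_kraus_rep Phi Ks -> (forall n, incoherent_kraus (Ks' n)) ->
    (forall x j y k, choi Ks' x j y k = choi Ks x j y k) ->
  incoherent_kraus_rep Phi Ks'.
Proof.
move=> [KsTP [_ KsE]] incK' eq_choi.
have gramE M (Q : 'I_M -> 'M[C]_d) i j :
    (\sum_n adjoint (Q n) *m Q n) i j = \sum_x choi Q x j x i.
  rewrite summxE exchange_big; apply: eq_bigr => n _; rewrite mxE.
  by apply: eq_bigr => x _; rewrite adjointE mulrC.
have actE M (Q : 'I_M -> 'M[C]_d) (rho : 'M[C]_d) x y :
    (\sum_n Q n *m rho *m adjoint (Q n)) x y
      = \sum_j \sum_k rho j k * choi Q x j y k.
  rewrite summxE (eq_bigr _ (fun n _ => kraus_entry (Q n) rho x y)) exchange_big.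
  apply: eq_bigr => j _; rewrite exchange_big; apply: eq_bigr => k _.
  by rewrite mulr_sumr.
split; [|split=> //].
- rewrite -KsTP; apply/matrixP => i j; rewrite !gramE.
  by apply: eq_bigr => x _; rewrite eq_choi.
- move=> rho; rewrite KsE; apply/matrixP => x y; rewrite !actE.
  by apply: eq_bigr => j _; apply: eq_bigr => k _; rewrite eq_choi.
Qed.

Theorem theorem1 (Phi : 'M[C]_3 -> 'M[C]_3) :
  incoherent_operation Phi ->
  exists (N : nat) (Ks : 'I_N -> 'M[C]_3),
    (N <= 32)%N /\ incoherent_kraus_rep Phi Ks.
Proof.
move=> [N [Ks KsP]]; have [_ [incK _]] := KsP.
have /fin_all_exists[f suppK] n := incoherent_kraus_fun (incK n).
have [N1 [f1 [tg1 [K1 [canK1 K1E]]]]] := canonical_exists suppK.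
have [N2 [f2 [tg2 [K2 [leN2 canK2 K2E]]]]] := canonical_le32 canK1.
exists N2, K2; split=> //; apply: eq_choi_kraus_rep KsP _ _.
  by move=> n; apply: incoherent_kraus_supp (canonical_supp canK2 (n := n)).
by move=> x j y k; rewrite K2E K1E.
Qed.
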